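(* Let $M$ be a simple conical refinement monoid (commutative). (1) If the stable ranks $\mathrm{sr}_M(a)$ of the elements $a \in M$ have a finite upper bound, then $M$ is cancellative, and all its elements have stable rank $1$. (2) The set $\mathrm{sr}_M(M \setminus \{0\}) := \{\mathrm{sr}_M(a) \mid a \in M \setminus \{0\}\}$ equals $\{1\}$ or $\{\infty\}$ or $\mathbb{Z}_{\ge 2}$. All three possibilities occur; that is, for each of the sets $\{1\}$, $\{\infty\}$, $\mathbb{Z}_{\ge 2}$ there exists a simple conical refinement monoid $N$ such that $\mathrm{sr}_N(N \setminus \{0\})$ equals that set.
   Context: All monoids are commutative and written additively. For a monoid $M$ and $a \in M$, the stable rank $\mathrm{sr}_M(a) \in \mathbb{Z}_{>0} \cup \{\infty\}$ is the least positive integer $n$ such that: for all $x,y \in M$ with $na + x = a + y$ there exists $e \in M$ with $na = a + e$ and $e + x = y$. If no such $n$ exists, $\mathrm{sr}_M(a) = \infty$. $M$ is conical if $x + y = 0$ implies $x = y = 0$ for any $x,y \in M$. The algebraic order on $M$: $x \le y$ iff $x + z = y$ for some $z \in M$. An o-ideal of $M$ is a submonoid $I$ such that $x \le y \in I$ implies $x \in I$. $M$ is simple if $M$ is not a group and its only o-ideals are its group of units $U(M)$ and $M$; for conical $M$ this means that $M \ne \{0\}$ and for every nonzero $u \in M$ and every $x \in M$ there is $n \in \mathbb{Z}_{>0}$ with $x \le nu$. $M$ is a refinement monoid if whenever $x_1 + x_2 = y_1 + y_2$ in $M$, there exist $z_{ij} \in M$ ($i,j \in \{1,2\}$) such that $x_i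 = z_{i1} + z_{i2}$ for $i = 1,2$ and $y_j = z_{1j} + z_{2j}$ for $j = 1,2$. $M$ is cancellative if $x + z = y + z$ implies $x = y$ for any $x,y,z \in M$. *)

(* Defs.v *)
From HB Require Import structures.
From mathcomp Require Import all_boot all_algebra.
From mathcomp Require Import boolp classical_sets.

Set Implicit Arguments.
Unset Strict Implicit.
Unset Printing Implicit Defensive.

Import GRing.Theory.

Local Open Scope classical_set_scope.
Local Open Scope ring_scope.

Definition conical (M : nmodType) : Prop :=
  forall x y : M, x + y = 0 -> x = 0 /\ y = 0.

Definition cancellative (M : nmodType) : Prop :=
  forall x y z : M, x + z = y + z -> x = y.

Definition refinement (M : nmodType) : Prop :=
  forall x1 x2 y1 y2 : M, x1 + x2 = y1 + y2 ->
    exists z11 z12 z21 z22 : M,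
      [/\ x1 = z11 + z12, x2 = z21 + z22, y1 = z11 + z21 & y2 = z12 + z22].

Definition alg_le (M : nmodType) (x y : M) : Prop := exists z : M, x + z = y.

Definition submonoid (M : nmodType) (I : set M) : Prop :=
  I 0 /\ (forall x y : M, I x -> I y -> I (x + y)).

Definition o_ideal (M : nmodType) (I : set M) : Prop :=
  submonoid I /\ (forall x y : M, alg_le x y -> I y -> I x).

Definition monoid_units (M : nmodType) : set M :=
  [set x | exists y : M, x + y = 0].

Definition is_group (M : nmodType) : Prop := @monoid_units M = setT.

Definition simple_monoid (M : nmodType) : Prop :=
  ~ is_group M /\
  (forall I : set M, o_ideal I -> I = @monoid_units M \/ I = setT).

Definition simple_conical_refinement (M : nmodType) : Prop :=
  [/\ simple_monoid M, conical M & refinement M].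

Definition sr_condition (M : nmodType) (a : M) (n : nat) : Prop :=
  forall x y : M, a *+ n + x = a + y ->
    exists2 e : M, a *+ n = a + e & e + x = y.

Definition sr_bound (M : nmodType) (a : M) : pred nat :=
  fun n => (0 < n)%N && `[< sr_condition a n >].

(* Values in the positive integers extended by infinity, encoded in
   [option nat]: [Some n] is the integer n and [None] is infinity. *)
Definition stable_rank (M : nmodType) (a : M) : option nat :=
  match pselect (exists n, sr_bound a n) with
  | left ex_n => Some (ex_minn ex_n)
  | right _ => None
  end.

Definition stable_ranks (M : nmodType) : set (option nat) :=
  @stable_rank M @` [set a | a <> 0].

(* Main.v *)
(** In a simple conical refinement monoid, stable rank at most [n] for [a] allows
    cancelling [a] from [a + x = a + y] as soon as [n a <= x].  If all stable
    ranks are at most [n], every element is a sum of pieces small enough for this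
    rule, so the monoid is cancellative.  One finite stable rank makes all of them
    finite, and a nonzero element of stable rank 1 cancels, hence so does
    everything.  In the remaining case stable ranks are unbounded, and along the
    multiples of an element of large stable rank they descend to 2 meeting every
    prescribed intermediate value.

    For the third example, give rational sizes to the elements and identify all
    elements of equal size at least 1.  Elements of size less than 1 come from
    successively adjoining free refinements [z_ij] (the letters of one stage) to
    every equation [x_1 + x_2 = y_1 + y_2] that holds so far or has size at least 1.
    A stage identifies no further small elements of the previous ones, so two free
    letters of size 1/2 stay distinct and cancellation fails; yet [x] and [y] are
    equal when they have the same size at least 1, so all stable ranks are finite. *)
Require Import Defs.
From HB Require Import structures.
From mathcomp Require Import all_boot all_order all_algebra.
From mathcomp Require Import boolp classical_sets.
From mathcomp Require Import zify lra.

Set Implicit Arguments.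
Unset Strict Implicit.
Unset Printing Implicit Defensive.

Import Order.TTheory GRing.Theory Num.Theory.

Local Open Scope classical_set_scope.
Local Open Scope quotient_scope.
Local Open Scope ring_scope.

(** * Stable rank conditions in an arbitrary commutative monoid *)

Section StableRankConditions.
Variable M : nmodType.
Implicit Types (a b c d u v x y z : M) (k l m n : nat).

Lemma alg_leD a b x y : alg_le a x -> alg_le b y -> alg_le (a + b) (x + y).
Proof. by move=> [p <-] [q <-]; exists (p + q); rewrite addrACA. Qed.

Lemma alg_le_addl a x : alg_le a (a + x).
Proof. by exists x. Qed.

Lemma alg_le_addr a x : alg_le a (x + a).
Proof. by exists x; rewrite addrC. Qed.

Lemma alg_le_trans y x z : alg_le x y -> alg_le y z -> alg_le x z.
Proof. by move=> [p <-] [q <-]; exists (p + q); rewrite addrA. Qed.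

Lemma alg_leMn a b n : alg_le a b -> alg_le (a *+ n) (b *+ n).
Proof. by move=> [p <-]; exists (p *+ n); rewrite mulrnDl. Qed.

Lemma alg_leMnr a k l : (k <= l)%N -> alg_le (a *+ k) (a *+ l).
Proof. by move=> kl; exists (a *+ (l - k)); rewrite -mulrnDr subnKC. Qed.

Lemma sr_conditionS a n : sr_condition a n -> sr_condition a n.+1.
Proof.
move=> sa x y; rewrite mulrSr -addrA => /sa [e ea ey].
by exists (e + a); rewrite ?addrA -?ea // -addrA.
Qed.

Lemma sr_condition_leq a m n :
  (m <= n)%N -> sr_condition a m -> sr_condition a n.
Proof.
move=> /subnK <- sa; elim: (n - m)%N => // k IHk; exact: sr_conditionS.
Qed.

Lemma sr_condition0 n : sr_condition (0 : M) n.
Proof.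
by move=> x y; rewrite mul0rn !add0r => ->; exists 0; rewrite !add0r.
Qed.

(* The remainder [e] produced by the stable rank condition is only known
   modulo [a]; a further summand [a] of [x] absorbs this ambiguity. *)
Lemma sr_condition_cancel a n x y : (0 < n)%N -> sr_condition a n ->
  alg_le (a *+ n) x -> a + x = a + y -> x = y.
Proof.
case: n => // n _ sa [z <-].
have -> : a + (a *+ n.+1 + z) = a *+ n.+1 + (a + z) by rewrite addrCA.
by move=> /sa [e ea <-]; rewrite addrA [e + a]addrC -ea.
Qed.

Lemma sr_condition_cancelMn a n k x y : (0 < n)%N -> sr_condition a n ->
  alg_le (a *+ n) x -> a *+ k + x = a *+ k + y -> x = y.
Proof.
move=> n0 sa le_x; elim: k => [|k IHk]; first by rewrite !add0r.
rewrite !mulrS -!addrA => /(sr_condition_cancel n0 sa) eq_k; apply/IHk/eq_k.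
by apply: alg_le_trans le_x _; apply: alg_le_addr.
Qed.

Lemma sr_condition_cancel_le a b n k x y : (0 < n)%N -> sr_condition a n ->
  alg_le b (a *+ k) -> alg_le (a *+ n) x -> b + x = b + y -> x = y.
Proof.
move=> n0 sa [c bc] le_x bxy; apply: (sr_condition_cancelMn (k := k) n0 sa le_x).
by rewrite -bc ![b + c]addrC -!addrA bxy.
Qed.

(** The summand [b *+ l] already lies above [a *+ n], so [b] can be cancelled from
    [b + (b *+ l + x) = b + y]; the remainder is then [b *+ l] itself. *)
Lemma sr_condition_le a b n k l : (0 < n)%N -> sr_condition a n ->
  alg_le b (a *+ k) -> alg_le (a *+ n) (b *+ l) -> sr_condition b l.+1.
Proof.
move=> n0 sa le_b le_a x y; rewrite mulrS -addrA => bxy.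
exists (b *+ l); rewrite ?mulrS //.
apply: (sr_condition_cancel_le n0 sa le_b) bxy.
exact: alg_le_trans le_a (alg_le_addl _ _).
Qed.

Lemma sr_condition_of_mulrn a k m : (0 < k)%N -> (0 < m)%N ->
  sr_condition (a *+ k) m -> sr_condition a (k * m).+1.
Proof.
move=> k0 m0 ska; apply: (sr_condition_le (k := 1) m0 ska).
  by rewrite mulr1n -{1}[a]mulr1n; apply: alg_leMnr.
by rewrite -mulrnA; apply: alg_leMnr.
Qed.

(** Cancelling [n] copies of [a] is allowed, because [n.+2] copies stay on the left. What remains is
    an instance of the condition for [a]; its remainder [z] yields the remainder [z + a]. *)
Lemma sr_condition_mulrn2 a n : sr_condition a n.+1 ->
  sr_condition (a *+ n.+1) 2.
Proof.
move=> sa x y; rewrite -mulrnA => eq_xy.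
suff [e ea ey] : exists2 e, a *+ n.+2 = a + e & e + x = y.
  exists e => //; rewrite [in RHS]mulrSr -addrA -ea -mulrnDr.
  by congr (_ *+ _); lia.
have [z az zy] : exists2 z, a *+ n.+1 = a + z & z + (a + x) = y.
  apply: (sa); rewrite addrA -mulrSr.
  have {eq_xy} : a *+ n + (a *+ n.+2 + x) = a *+ n + (a + y).
    rewrite addrA -mulrnDr [RHS]addrA -mulrSr -eq_xy; congr (_ *+ _ + _); lia.
  apply: (sr_condition_cancelMn _ sa) => //.
  exact: alg_le_trans (alg_leMnr a (leqnSn _)) (alg_le_addl _ _).
exists (z + a); first by rewrite addrA -az mulrSr.
by rewrite -addrA.
Qed.

(** Adding [c] to both sides gives an instance of the condition for [c *+ k.+1], with [k - m + 1]
    spare copies of [c] on the left. One spare copy makes up for the difference between [c *+ k] and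
    [c *+ k.+1]. *)
Lemma sr_condition_pred_mulrn c k m : (m <= k)%N ->
  sr_condition (c *+ k.+1) m -> sr_condition (c *+ k) m.+1.
Proof.
move=> le_mk sc x y eq_xy.
have eq_r : (k * m.+1).+1 = (k.+1 * m + (k - m).+1)%N by nia.
have [e ce ey] : exists2 e, c *+ k.+1 *+ m = c *+ k.+1 + e
                          & e + (c *+ (k - m).+1 + x) = y.
  apply: sc; rewrite addrA -mulrnA -mulrnDr -eq_r mulrS -addrA mulrnA eq_xy.
  by rewrite addrA -mulrS.
exists (e + c *+ (k - m).+1); last by rewrite -addrA.
rewrite [c *+ (k - m).+1]mulrS [e + _]addrCA addrA -mulrSr addrA -ce.
by rewrite -!mulrnA -mulrnDr; congr (_ *+ _); nia.
Qed.

End StableRankConditions.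

Lemma stable_rankP (M : nmodType) (a : M) (n : nat) :
  stable_rank a = Some n <->
  [/\ (0 < n)%N, sr_condition a n &
      forall m : nat, (0 < m)%N -> sr_condition a m -> (n <= m)%N].
Proof.
rewrite /stable_rank; case: pselect => [ex|nex]; split.
- move=> [<-]; case: ex_minnP => m /andP[m0 /asboolP sm] min_m; split=> // k k0 sk.
  by apply: min_m; rewrite /sr_bound k0; apply/asboolP.
- move=> [n0 sn min_n]; congr Some; case: ex_minnP => m /andP[m0 /asboolP sm] min_m.
  apply/eqP; rewrite eqn_leq min_n // andbT; apply: min_m.
  by rewrite /sr_bound n0; apply/asboolP.
- by [].
- by move=> [n0 sn _]; case: nex; exists n; rewrite /sr_bound n0; apply/asboolP.
Qed.

Lemma stable_rank_None (M : nmodType) (a : M) :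
  stable_rank a = None <-> forall n : nat, (0 < n)%N -> ~ sr_condition a n.
Proof.
rewrite /stable_rank; case: pselect => [ex|nex]; split => //.
- by move=> no_n; exfalso; case: ex => n /andP[n0 /asboolP]; exact: no_n.
- move=> _ n n0 sn; case: nex; exists n; rewrite /sr_bound n0; exact/asboolP.
Qed.

Lemma stable_rank_fin (M : nmodType) (a : M) (n : nat) : (0 < n)%N ->
  sr_condition a n -> exists2 m : nat, stable_rank a = Some m & (m <= n)%N.
Proof.
move=> n0 sn; case E: (stable_rank a) => [m|].
  by exists m => //; have /stable_rankP[_ _] := E; apply.
by move/stable_rank_None: E => /(_ n n0).
Qed.

Lemma cancellative_stable_rank (M : nmodType) (a : M) :
  cancellative M -> stable_rank a = Some 1%N.
Proof.
move=> cM; apply/stable_rankP; split=> // x y; rewrite mulr1n.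
rewrite ![a + _]addrC => /cM ->; exists 0; rewrite ?add0r ?addr0 //.
Qed.

(** * Cancellation and possible stable ranks in simple conical monoids *)

Section SimpleConical.
Variable M : nmodType.
Hypotheses (simM : simple_monoid M) (conM : conical M).
Implicit Types (a b c d u v x y z : M) (k l m n : nat).

Lemma conical_units x : monoid_units x -> x = 0.
Proof. by move=> [y /conM[]]. Qed.

Lemma simple_nontrivial : exists a : M, a <> 0.
Proof.
have [ngM _] := simM; apply/existsNP => all0; apply: ngM.
by apply/seteqP; split=> // x _; exists 0; rewrite addr0; exact: all0.
Qed.

(** The elements below some multiple of [u] form an o-ideal containing [u], which is not a unit. *)
Lemma simple_archimedean u x : u <> 0 -> exists n, alg_le x (u *+ n).
Proof.
move=> u0; have [_ /(_ [set y | exists n, alg_le y (u *+ n)])] := simM.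
case.
- split; first split.
  + by exists 0%N, 0; rewrite addr0.
  + move=> y z [k le_y] [l le_z]; exists (k + l)%N.
    by rewrite mulrnDr; apply: alg_leD.
  + move=> y z le_yz [n le_z]; exists n; exact: alg_le_trans le_z.
- move=> eqU; case: u0; apply: conical_units.
  by rewrite -eqU; exists 1%N, 0; rewrite addr0.
- by move/seteqP => [_ /(_ x I)].
Qed.

(** Otherwise [v] absorbs every multiple of [d], hence some element above [v *+ n.+1]. The stable
    rank condition then writes 0 as a sum containing [v], so [v = 0] and [d = 0]. *)
Lemma sr_condition_addr_eq0 v d n : (0 < n)%N -> sr_condition v n ->
  v + d = v -> d = 0.
Proof.
move=> n0 sv vd; apply: contrapT => d0.
have vdk k : v + d *+ k = v by elim: k => [|k IHk]; rewrite ?addr0 // mulrS addrA vd.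
have [k [z dk]] := simple_archimedean (v *+ n.+1) d0.
have /sv[e _ /conM[_ /conM[v0 _]]] : v *+ n + (v + (v + z)) = v + 0.
  by rewrite addr0 -[RHS](vdk k) -dk mulrSr -addrA addrCA.
by apply: d0; move: vd; rewrite v0 add0r.
Qed.

Lemma sr_condition_all a b n : a <> 0 -> b <> 0 -> (0 < n)%N ->
  sr_condition a n -> exists2 m, (0 < m)%N & sr_condition b m.
Proof.
move=> a0 b0 n0 sa; have [k bk] := simple_archimedean b a0.
have [l al] := simple_archimedean (a *+ n) b0.
by exists l.+1 => //; apply: sr_condition_le n0 sa bk al.
Qed.

(** Stable rank 1 leaves a remainder [e] with [a = a + e], hence [e = 0] and [a] cancels. Every
    element lies below a multiple of [a]. *)
Lemma sr_condition1_cancellative a : a <> 0 -> sr_condition a 1 ->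
  cancellative M.
Proof.
move=> a0 sa; have aI x y : a + x = a + y -> x = y.
  rewrite -{1}[a]mulr1n => /sa [e ae <-].
  by rewrite (sr_condition_addr_eq0 _ sa (esym ae)) ?add0r.
have anI n x y : a *+ n + x = a *+ n + y -> x = y.
  by elim: n => [|n IHn]; rewrite ?add0r // mulrS -!addrA => /aI /IHn.
move=> x y z; have [n [t zt]] := simple_archimedean z a0.
by rewrite ![_ + z]addrC => xy; apply: (anI n); rewrite -zt addrAC xy addrAC.
Qed.

(** Refining [u + z = v + v *+ n] splits [u] into a piece below [v] and a piece below [v *+ n]. *)
Lemma decompose_bounded u v n : refinement M -> alg_le u (v *+ n) ->
  exists s : seq M, u = \sum_(w <- s) w /\ forall w, w \in s -> alg_le w v.
Proof.
move=> refM; elim: n => [|n IHn] in u *.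
  by move=> [z /conM[-> _]]; exists [::]; rewrite big_nil.
move=> [z]; rewrite mulrS => /refM [z11 [z12 [z21 [z22 [-> _ v_eq eq_v]]]]].
have [|s [-> le_s]] := IHn z12; first by rewrite eq_v; apply: alg_le_addl.
exists (z11 :: s); rewrite big_cons; split=> // w; rewrite inE => /orP[/eqP->|/le_s //].
by rewrite v_eq; apply: alg_le_addl.
Qed.

Lemma common_lower_bound p q : refinement M -> p <> 0 -> q <> 0 ->
  exists v, [/\ v <> 0, alg_le v p & alg_le v q].
Proof.
move=> refM p0 q0; have [n pn] := simple_archimedean p q0.
have [s [ps le_s]] := decompose_bounded refM pn.
have [w [ws w0]] : exists w, w \in s /\ w <> 0.
  apply: contrapT => no_w; apply: p0; rewrite ps big1_seq // => w /= ws.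
  by apply: contrapT => w0; apply: no_w; exists w.
exists w; split=> //; last exact: le_s.
by rewrite ps (big_rem w) //=; apply: alg_le_addl.
Qed.

Definition atom p := p <> 0 /\ forall x y, p = x + y -> x = 0 \/ y = 0.

(** Repeated halving: if [v = p + q] with nonzero summands, a common lower bound [w] of [p] and [q]
    has [w *+ 2] below [v]. *)
Lemma non_atom_divide x k : refinement M -> ~ (exists p, atom p) -> x <> 0 ->
  exists v, v <> 0 /\ alg_le (v *+ 2 ^ k) x.
Proof.
move=> refM no_atom x0; elim: k => [|k [v [v0 le_v]]].
  by exists x; split=> //; exists 0; rewrite addr0.
have [p [q [vpq p0 q0]]] : exists p q, [/\ v = p + q, p <> 0 & q <> 0].
  apply: contrapT => npq; apply: no_atom; exists v; split=> // p q vpq.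
  apply: contrapT => /not_orP[p0 q0]; apply: npq; by exists p, q.
have [w [w0 wp wq]] := common_lower_bound refM p0 q0.
exists w; split=> //; apply: alg_le_trans le_v; rewrite expnS mulrnA.
by apply: alg_leMn; rewrite vpq mulr2n; apply: alg_leD.
Qed.

Lemma atom_multiples p u : refinement M -> atom p -> exists k, u = p *+ k.
Proof.
move=> refM [p0 atp]; have [n un] := simple_archimedean u p0.
have [s [-> le_s]] := decompose_bounded refM un; elim: s le_s {un} => [|w s IHs] le_s.
  by exists 0%N; rewrite big_nil.
have [|k sk] := IHs; first by move=> x xs; apply: le_s; rewrite inE xs orbT.
rewrite big_cons sk; have [z /esym pz] : alg_le w p by apply: le_s; rewrite mem_head.
case: (atp _ _ pz) => z0; first by exists k; rewrite z0 add0r.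
by exists k.+1; rewrite pz z0 addr0 -mulrS.
Qed.

(** If there is an atom, all elements are multiples of it, and distinct multiples stay distinct
    after adding one because no element absorbs a nonzero one. Without atoms, [x] lies above [n]
    copies of some nonzero [v], and [u] below a multiple of [v], so [u] cancels. *)
Lemma sr_condition_bounded_cancellative n : refinement M -> (0 < n)%N ->
  (forall a, sr_condition a n) -> cancellative M.
Proof.
move=> refM n0 srM x y u; rewrite ![_ + u]addrC => uxy.
have [x0|x0] := pselect (x = 0).
  move: uxy; rewrite x0 addr0 => /esym uy.
  by rewrite (sr_condition_addr_eq0 n0 (srM u) uy).
have [[p atp]|no_atom] := pselect (exists p, atom p).
  have eq_Mn i k l : (k <= l)%N -> p *+ i + p *+ k = p *+ i + p *+ l -> k = l.
    move=> kl eq_kl; have : p *+ (l - k) = 0.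
      apply: (sr_condition_addr_eq0 n0 (srM (p *+ (i + k)))).
      by rewrite -mulrnDr -addnA subnKC // [RHS]mulrnDr eq_kl mulrnDr.
    case E: (l - k)%N => [|j]; first by lia.
    by have [p0 _] := atp; rewrite mulrS => /conM[].
  have [i ui] := atom_multiples u refM atp.
  have [k xk] := atom_multiples x refM atp.
  have [l yl] := atom_multiples y refM atp.
  rewrite ui xk yl in uxy *; case/orP: (leq_total k l) => kl.
    by rewrite (eq_Mn i k l).
  by rewrite (eq_Mn i l k).
have [v [v0 le_v]] := non_atom_divide n refM no_atom x0.
have [k uk] := simple_archimedean u v0.
apply: (sr_condition_cancel_le n0 (srM v) uk) uxy.
apply: alg_le_trans le_v; apply: alg_leMnr; exact/ltnW/ltn_expl.
Qed.

Lemma sr_condition_unbounded m : refinement M -> ~ cancellative M -> (0 < m)%N ->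
  exists2 c : M, c <> 0 & ~ sr_condition c m.
Proof.
move=> refM ncM m0; apply: contrapT => no_c; apply: ncM.
apply: (sr_condition_bounded_cancellative refM m0) => a.
have [->|a0] := pselect (a = 0); first exact: sr_condition0.
by apply: contrapT => sa; apply: no_c; exists a.
Qed.

(* Along the multiples [c *+ k] of an element of large stable rank, the stable
   rank descends to 2 and cannot drop from above [m] to below [m] in one step. *)
Lemma stable_rank_intermediate m : refinement M -> ~ cancellative M ->
  (exists a n, [/\ a <> 0, (0 < n)%N & sr_condition a n]) -> (2 <= m)%N ->
  exists2 a : M, a <> 0 & stable_rank a = Some m.
Proof.
move=> refM ncM [a0 [n0 [a00 n00 sa0]]] m2.
have finM b : b <> 0 -> exists2 n, (0 < n)%N & sr_condition b n.
  by move=> b0; apply: sr_condition_all sa0.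
(* Failure of the bound [(m * m).+1] at [c] forces [m <= k] below: for [k < m], the bound [m] at
   [c *+ k.+1] would give it. *)
have [c c0 nsc] := sr_condition_unbounded refM ncM (ltn0Sn (m * m)).
have ck0 k : c *+ k.+1 <> 0 by rewrite mulrS => /conM[].
have ex_k : exists k, `[< sr_condition (c *+ k.+1) m >].
  have [[|n] // _ sn] := finM c c0; exists n; apply/asboolP.
  exact: sr_condition_leq (sr_condition_mulrn2 sn).
have [k /asboolP sk min_k] := ex_minnP ex_k.
exists (c *+ k.+1) => //; apply/stable_rankP; split=> // [|l l0 sl].
  exact: ltn_trans m2.
rewrite leqNgt; apply/negP => lm.
have mk : (m <= k)%N.
  rewrite leqNgt; apply/negP => km; apply: nsc.
  apply: sr_condition_leq (sr_condition_of_mulrn (ltn0Sn k) _ sk); last exact: ltnW.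
  by rewrite ltnS leq_mul2r km orbT.
(* The bound [m.-1] here would give the bound [m] at the previous multiple of [c], against the
   minimality of [k]. *)
have slm : sr_condition (c *+ k.+1) m.-1 by apply: sr_condition_leq sl; lia.
case: k => [|k] in sk min_k mk slm sl *; first by lia.
have /min_k : `[< sr_condition (c *+ k.+1) m >]; last by rewrite ltnn.
apply/asboolP; rewrite -(ltn_predK m2); apply: sr_condition_pred_mulrn slm; lia.
Qed.

Lemma stable_ranks_cancellative :
  cancellative M -> @stable_ranks M = [set Some 1%N].
Proof.
move=> cM; apply/seteqP; split=> [_ [a _ <-]|_ ->] /=.
  exact: cancellative_stable_rank.
have [a a0] := simple_nontrivial; exists a => //.
exact: cancellative_stable_rank.
Qed.

Lemma stable_ranks_infinite :
  (forall a n, a <> 0 -> (0 < n)%N -> ~ sr_condition a n) ->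
  @stable_ranks M = [set None].
Proof.
move=> inf; apply/seteqP; split=> [_ [a a0 <-]|_ ->] /=.
  by apply/stable_rank_None => n n0; exact: inf.
have [a a0] := simple_nontrivial; exists a => //.
by apply/stable_rank_None => n n0; exact: inf.
Qed.

Lemma stable_ranks_ge2 : refinement M -> ~ cancellative M ->
  (exists a n, [/\ a <> 0, (0 < n)%N & sr_condition a n]) ->
  @stable_ranks M = [set Some n | n in [set n : nat | (2 <= n)%N]].
Proof.
move=> refM ncM finM; apply/seteqP; split=> [_ [a /= a0 <-]|_ [m /= m2 <-]]; last first.
  by have [a a0 <-] := stable_rank_intermediate refM ncM finM m2; exists a.
have [b [n [b0 n0 sb]]] := finM.
have [m m0 sa] := sr_condition_all b0 a0 n0 sb.
have [[//|[|l]] sal _] := stable_rank_fin m0 sa; last by exists l.+2.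
  by have /stable_rankP[] := sal.
by have /stable_rankP[_ /(sr_condition1_cancellative a0)] := sal.
Qed.

End SimpleConical.

(** * Formal combinations and words in the letters *)

Section Combinations.
Variable I : finType.
Implicit Types (r s : {ffun I -> nat}) (p : I).

Definition comb (V : nmodType) (f : I -> V) r : V := \sum_p f p *+ r p.

Definition dirac p : {ffun I -> nat} := [ffun q => (q == p : nat)].

Lemma combD (V : nmodType) (f : I -> V) r s :
  comb f (r + s) = comb f r + comb f s.
Proof. by rewrite -big_split; apply: eq_bigr => p _; rewrite ffunE mulrnDr. Qed.

Lemma comb0 (V : nmodType) (f : I -> V) : comb f 0 = 0.
Proof. by apply: big1 => p _; rewrite ffunE. Qed.

Lemma comb_dirac (V : nmodType) (f : I -> V) p : comb f (dirac p) = f p.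
Proof.
rewrite /comb (bigD1 p) //= big1 => [|q qp]; first by rewrite ffunE eqxx addr0.
by rewrite ffunE (negPf qp).
Qed.

Lemma comb_sum_dirac (V : nmodType) (f : I -> V) (J : finType) (P : pred J)
  (h : J -> I) : comb f (\sum_(j | P j) dirac (h j)) = \sum_(j | P j) f (h j).
Proof.
elim/big_rec2: _ => [|j y r _ <-]; first exact: comb0.
by rewrite combD comb_dirac.
Qed.

Lemma dirac_split p r : (0 < r p)%N -> exists s, r = s + dirac p.
Proof.
move=> rp; exists [ffun q => r q - (q == p)]%N; apply/ffunP => q; rewrite !ffunE.
by rewrite -[RHS]/(_ + _)%N; case: eqP => [->|_]; lia.
Qed.

End Combinations.

(* The coefficient of ['X^n] counts the occurrences of the letters [z_ij] of
   stage [n]. *)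
Notation word := {poly 'M[nat]_2}.

Section Words.
Implicit Types (u v w x y : word) (A B : 'M[nat]_2) (p : bool * 'I_2).

(* The letters of row [i] for [p = (false, i)], of column [i] for
   [p = (true, i)]; a stage identifies [g n p] with the word [line p]. *)
Definition line p : 'M[nat]_2 :=
  \matrix_(k, l) nat_of_bool ((if p.1 then l else k) == p.2).

Lemma comb_lineE (r : {ffun bool * 'I_2 -> nat}) k l :
  comb line r k l = (r (false, k) + r (true, l))%N.
Proof.
rewrite /comb summxE (eq_bigr (fun p => (line (p.1, p.2) *+ r (p.1, p.2)) k l));
  last by case.
rewrite -(pair_bigA _ (fun b i => (line (b, i) *+ r (b, i)) k l)) /=.
have sumE (c : 'I_2 -> nat) (m : 'I_2) :
    \sum_(i < 2) nat_of_bool (m == i) *+ c i = c m.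
  rewrite (bigD1 m) //= eqxx natn big1 ?addr0 // => i im.
  by rewrite eq_sym (negPf im) mul0rn.
rewrite big_bool [RHS]addnC /= -[RHS]/(_ + _); congr (_ + _).
  rewrite -[RHS](sumE (fun i => r (true, i))).
  by apply: eq_bigr => i _; rewrite mulmxnE mxE.
rewrite -[RHS](sumE (fun i => r (false, i))).
by apply: eq_bigr => i _; rewrite mulmxnE mxE.
Qed.

Lemma sum_line b : \sum_i line (b, i) = const_mx 1%N.
Proof.
apply/matrixP => k l; rewrite summxE mxE (bigD1 (if b then l else k)) //=.
by rewrite mxE eqxx big1 // => i /negPf ik; rewrite mxE /= eq_sym ik.
Qed.

Definition letters (n : nat) A : word := A *: 'X^n.

Lemma coef_letters n A k : (letters n A)`_k = if k == n then A else 0.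
Proof. by rewrite coefZ coefXn; case: eqP; rewrite ?mulr1 ?mulr0. Qed.

Lemma lettersD n A B : letters n (A + B) = letters n A + letters n B.
Proof. exact: scalerDl. Qed.

Definition del (k : nat) w : word :=
  \poly_(i < size w) (if i == k then 0 else w`_i).

Lemma coef_del k w i : (del k w)`_i = if i == k then 0 else w`_i.
Proof.
rewrite coef_poly; case: ltnP => // /leq_sizeP -> //.
by case: ifP.
Qed.

Lemma delD k u v : del k (u + v) = del k u + del k v.
Proof.
by apply/polyP => i; rewrite coefD !coef_del coefD; case: eqP; rewrite ?addr0.
Qed.

Lemma del_letters n A : del n (letters n A) = 0.
Proof.
by apply/polyP => i; rewrite coef_del coef_letters coef0; case: eqP.
Qed.

Lemma del_id k w : w`_k = 0 -> del k w = w.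
Proof. by move=> wk; apply/polyP => i; rewrite coef_del; case: eqP => // ->. Qed.

Lemma del_lettersK k w : del k w + letters k w`_k = w.
Proof.
apply/polyP => i; rewrite coefD coef_del coef_letters.
by case: eqP => [->|_]; rewrite ?add0r ?addr0.
Qed.

End Words.

(** * The tower of congruences, its conservativity, and its limit *)

Section Tower.
Variables (t : nat -> 'I_2 -> 'I_2 -> rat) (g : nat -> bool * 'I_2 -> word).
Hypothesis t_gt0 : forall n i j, 0 < t n i j.
Implicit Types (u v w x y : word) (A B : 'M[nat]_2) (p : bool * 'I_2).
Implicit Types (m n k : nat).

Definition weight n A : rat := \sum_i \sum_j (A i j)%:R * t n i j.

Lemma weight0 n : weight n 0 = 0.
Proof. by apply: big1 => i _; apply: big1 => j _; rewrite mxE mul0r. Qed.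

Lemma weightD n A B : weight n (A + B) = weight n A + weight n B.
Proof.
rewrite -big_split; apply: eq_bigr => i _; rewrite -big_split.
by apply: eq_bigr => j _; rewrite mxE natrD mulrDl.
Qed.

Lemma weight_ge0 n A : 0 <= weight n A.
Proof.
by apply: sumr_ge0 => i _; apply: sumr_ge0 => j _; rewrite mulr_ge0 // ltW.
Qed.

Lemma weight_eq0 n A : weight n A = 0 -> A = 0.
Proof.
have ge0 i j : 0 <= (A i j)%:R * t n i j by rewrite mulr_ge0 // ltW.
move=> A0; apply/matrixP => i j; rewrite mxE.
have Ai := psumr_eq0P (fun i _ => sumr_ge0 _ (fun j _ => ge0 i j)) A0 (i := i) isT.
have /eqP := psumr_eq0P (fun j _ => ge0 i j) Ai (i := j) isT.
by rewrite mulf_eq0 (gt_eqF (t_gt0 n i j)) orbF pnatr_eq0 => /eqP.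
Qed.

Definition wsize w : rat := \sum_(n < size w) weight n w`_n.

Lemma wsizeE N w : (size w <= N)%N -> wsize w = \sum_(n < N) weight n w`_n.
Proof.
move=> le_wN; rewrite /wsize (big_ord_widen N (fun n => weight n w`_n)) //.
rewrite big_mkcond; apply: eq_bigr => i _; case: ltnP => // /leq_sizeP -> //.
by rewrite weight0.
Qed.

Lemma wsizeD u v : wsize (u + v) = wsize u + wsize v.
Proof.
rewrite !(@wsizeE (maxn (size u) (size v))) ?leq_maxl ?leq_maxr ?size_polyD //.
by rewrite -big_split; apply: eq_bigr => i _; rewrite coefD weightD.
Qed.

Lemma wsize0 : wsize 0 = 0.
Proof. by rewrite /wsize size_poly0 big_ord0. Qed.

Lemma wsize_letters n A : wsize (letters n A) = weight n A.
Proof.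
rewrite (@wsizeE n.+1); last first.
  by apply/leq_sizeP => k nk; rewrite coef_letters gtn_eqF.
rewrite big_ord_recr /= coef_letters eqxx big1 ?add0r // => i _.
by rewrite coef_letters ltn_eqF ?weight0.
Qed.

Lemma wsize_ge0 w : 0 <= wsize w.
Proof. by apply: sumr_ge0 => i _; exact: weight_ge0. Qed.

Lemma wsize_eq0 w : wsize w = 0 -> w = 0.
Proof.
move=> w0; apply/polyP => k; rewrite coef0.
case: (ltnP k (size w)) => [kw|/leq_sizeP -> //]; apply: (@weight_eq0 k).
have ge0 (i : 'I_(size w)) : true -> 0 <= weight i w`_i by rewrite weight_ge0.
exact: (psumr_eq0P ge0 w0 (i := Ordinal kw) isT).
Qed.

Lemma wsizeMn w n : wsize (w *+ n) = wsize w *+ n.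
Proof.
by elim: n => [|n IHn]; rewrite ?wsize0 // !mulrS wsizeD IHn.
Qed.

(** Reflexivity is not a constructor: each stage inherits it from the previous one, down to equality
    at stage 0. *)
Inductive congruence_closure (R : word -> word -> Prop) : word -> word -> Prop :=
| closure_base u v : R u v -> congruence_closure R u v
| closure_sym u v : congruence_closure R u v -> congruence_closure R v u
| closure_trans v u w : congruence_closure R u v -> congruence_closure R v w ->
    congruence_closure R u w
| closure_add u v w : congruence_closure R u v ->
    congruence_closure R (u + w) (v + w).

(* Letter sizes are prescribed in advance rather than computed from the equation,
   so a stage only takes effect if they have the right row and column sums. *)
Definition active (R : word -> word -> Prop) n : Prop :=
  [/\ forall p, (size (g n p) <= n)%N,
      forall p, wsize (g n p) = wsize (letters n (line p)) &
      R (\sum_i g n (false, i)) (\sum_i g n (true, i)) \/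
      1 <= wsize (letters n (const_mx 1%N))].

Fixpoint stage n : word -> word -> Prop :=
  if n is m.+1 then
    congruence_closure (fun u v => stage m u v \/
      active (stage m) m /\ exists2 p, u = g m p & v = letters m (line p))
  else eq.

Lemma stage_sym n u v : stage n u v -> stage n v u.
Proof. case: n => [-> //|n]; exact: closure_sym. Qed.

Lemma stage_trans n v u w : stage n u v -> stage n v w -> stage n u w.
Proof. case: n => [-> //|n]; exact: closure_trans. Qed.

Lemma stage_add n u v w : stage n u v -> stage n (u + w) (v + w).
Proof. case: n => [-> //|n]; exact: closure_add. Qed.

Lemma stage_refl n u : stage n u u.
Proof. by elim: n => // n IHn; apply: closure_base; left. Qed.

Lemma stage_leq m n u v : (m <= n)%N -> stage m u v -> stage n u v.
Proof.
move=> /subnK <- uv; elim: (n - m)%N => // k IHk.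
by apply: closure_base; left.
Qed.

Lemma stage_wsize n u v : stage n u v -> wsize u = wsize v.
Proof.
elim: n u v => [u v -> //|n IHn u v].
elim=> {u v} [u v [/IHn//|[[_ gs _] [p -> ->]]]| |v u w _ -> |u v w _ uv] //.
by rewrite !wsizeD uv.
Qed.

(** The equations imposed before stage [n] contain only letters of stages below [n], so later
    letters are carried along as mere context. *)
Lemma stage_inert k n u v : (n <= k)%N -> stage n u v ->
  u`_k = v`_k /\ stage n (del k u) (del k v).
Proof.
elim: n u v => [u v _ -> //|n IHn u v nk].
elim=> {u v} [u v [uv|[act [p -> ->]]]|u v _ [-> vu]|v u w _ [-> uv] _ [-> vw]
             |u v w _ [uv1 uv2]].
- by have [-> ?] := IHn _ _ (ltnW nk) uv; split=> //; apply: closure_base; left.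
- have [gn _ _] := act.
  have gk : (g n p)`_k = 0 by apply/leq_sizeP: (leq_trans (gn p) (ltnW nk)).
  have lk : (letters n (line p))`_k = 0 by rewrite coef_letters gtn_eqF.
  rewrite gk lk !del_id //; split=> //; apply: closure_base; right; split=> //.
  by exists p.
- by split=> //; exact: stage_sym vu.
- by split=> //; exact: (@stage_trans n.+1) uv vw.
- by rewrite !coefD uv1 !delD; split=> //; exact: (@stage_add n.+1).
Qed.

(* Grouping the letters of stage [n] into full lines and replacing each line by the
   element it subdivides is invariant under stage [n.+1]: groupings differ by
   trading all rows for all columns, and this is the equation being refined (or
   requires size at least 1). *)
Definition collapse n w x := exists2 r : {ffun bool * 'I_2 -> nat},
  w`_n = comb line r & stage n (del n w + comb (g n) r) x.

(** If the grouping [r] uses the line [p], that line is removed from it. Otherwise the lines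
    crossing [p] are traded for those parallel to it, after which [p] occurs. *)
Lemma collapse_line n p w x : active (stage n) n ->
  wsize (letters n (line p) + w) < 1 ->
  collapse n (letters n (line p) + w) x -> collapse n (g n p + w) x.
Proof.
case: p => b i [gn gs act] small [r]; rewrite delD del_letters add0r coefD.
rewrite coef_letters eqxx => rE wx.
have gb0 : (g n (b, i))`_n = 0 by apply/leq_sizeP: (gn (b, i)).
suff [s wE sr] : exists2 s, w`_n = comb line s &
    stage n (g n (b, i) + comb (g n) s) (comb (g n) r).
  exists s; first by rewrite coefD gb0 add0r.
  apply: stage_trans wx; rewrite delD (del_id gb0) -addrA addrCA ![del n w + _]addrC.
  exact: stage_add.
have [/dirac_split[s rs]|] := ltnP 0 (r (b, i)).
  exists s; last by rewrite rs combD comb_dirac addrC; exact: stage_refl.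
  apply/matrixP => k l; apply/(@addnI (line (b, i) k l)).
  by move/matrixP/(_ k l): rE; rewrite rs combD comb_dirac addrC !mxE.
(* Each letter of the line [(b, i)] must now be covered by the line crossing it there, so [r] uses
   all lines of the other direction. *)
rewrite leqn0 => /eqP r0.
have r_gt0 j : (0 < r (~~ b, j))%N.
  move/matrixP: rE; case: b r0 {gb0 small} => r0 /=.
    by move/(_ j i); rewrite comb_lineE r0 !mxE eqxx; lia.
  by move/(_ i j); rewrite comb_lineE r0 !mxE eqxx; lia.
have [s rs] : exists s, r = s + \sum_j dirac (~~ b, j).
  have [s1 rs1] := dirac_split (r_gt0 ord0).
  have [|s2 rs2] := @dirac_split _ (~~ b, lift ord0 ord0) s1.
    by have := r_gt0 (lift ord0 ord0); rewrite rs1 !ffunE xpair_eqE andbF addr0.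
  by exists s2; rewrite big_ord_recl big_ord1 rs1 rs2 -addrA [in LHS](addrC (dirac _)).
(* All crossing lines are replaced by all parallel ones, and the line [(b, i)] itself is dropped. *)
exists (s + \sum_(j | j != i) dirac (b, j)).
  apply/matrixP => k l; apply/(@addnI (line (b, i) k l)).
  move/matrixP/(_ k l): rE.
  rewrite rs !combD !comb_sum_dirac sum_line -(sum_line b) (bigD1 i) //=.
  by rewrite addrCA !mxE.
have -> : g n (b, i) + comb (g n) (s + \sum_(j | j != i) dirac (b, j)) =
          \sum_j g n (b, j) + comb (g n) s.
  by rewrite combD comb_sum_dirac [in RHS](bigD1 i) //= -addrA [comb _ s + _]addrC.
rewrite rs combD comb_sum_dirac [X in stage n _ X]addrC; apply: stage_add.
case: act => [|large]; first by case: (b) => // /stage_sym.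
(* The word contains one copy of every letter of stage [n], so its size would be at least 1. *)
move: small; rewrite ltNge => /negP[]; apply: le_trans large _.
rewrite -[w](del_lettersK n) addrCA -lettersD rE rs combD comb_sum_dirac sum_line.
by rewrite lettersD !wsizeD addrA lerDr addr_ge0 ?wsize_ge0.
Qed.

Lemma collapse_stage n u v x : wsize u < 1 -> stage n.+1 u v ->
  collapse n u x <-> collapse n v x.
Proof.
(* The context [w] is generalised because [closure_add] enlarges it. *)
move=> small uv; suff : forall w, wsize (u + w) < 1 ->
    collapse n (u + w) x <-> collapse n (v + w) x.
  by move=> /(_ 0); rewrite !addr0; apply.
elim: uv {small} => {u v} [u v [uv|[act [p -> ->]]]|u v vu IH|v u w uv IHu _ IHv
             |u v w _ IH] z small.
- have [uvn uvd] := stage_inert (leqnn n) uv.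
  rewrite /collapse !delD !coefD uvn; split=> -[r rE rx]; exists r => //;
    apply: stage_trans rx; rewrite -!addrA; apply: stage_add => //.
  exact: stage_sym.
- have [gn gs _] := act.
  have gp0 : (g n p)`_n = 0 by apply/leq_sizeP: (gn p).
  split; last by apply: collapse_line act _; rewrite wsizeD -gs -wsizeD.
  case=> r rE rx; exists (dirac p + r).
    by rewrite coefD coef_letters eqxx combD comb_dirac -rE coefD gp0 add0r.
  move: rx; rewrite !delD del_letters add0r (del_id gp0) combD comb_dirac.
  by rewrite addrCA addrA.
- by apply: iff_sym; apply: IH; rewrite wsizeD (stage_wsize (n := n.+1) vu) -wsizeD.
- apply: iff_trans (IHu _ small) (IHv _ _).
  by rewrite wsizeD -(stage_wsize (n := n.+1) uv) -wsizeD.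
- by rewrite -!addrA; apply: IH; rewrite addrA.
Qed.

(** The word [u] collapses to itself by the empty grouping, hence so does [v] collapse to [u]; as
    [v] has no letters of stage [n], its grouping is empty too. *)
Lemma stage_conservative n u v : u`_n = 0 -> v`_n = 0 -> wsize u < 1 ->
  stage n.+1 u v -> stage n u v.
Proof.
move=> un vn small uv.
have /(collapse_stage _ small uv)[r rE] : collapse n u u.
  by exists 0; rewrite comb0 ?un // addr0 del_id //; exact: stage_refl.
have -> : r = 0.
  apply/ffunP => -[b i]; rewrite ffunE; move: rE; rewrite vn => /matrixP/(_ i i).
  rewrite comb_lineE mxE => /esym/eqP; rewrite addn_eq0 => /andP[/eqP r0 /eqP r1].
  by case: b.
by rewrite comb0 addr0 del_id //; exact: stage_sym.
Qed.

Lemma stage_inactive n u v : ~ active (stage n) n -> stage n.+1 u v -> stage n u v.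
Proof.
move=> nact; elim=> {u v} [u v [//|[]]//|u v _|v u w _ uv _|u v w _].
- exact: stage_sym.
- exact: stage_trans.
- exact: stage_add.
Qed.

Definition limit_rel u v : Prop :=
  wsize u = wsize v /\ (1 <= wsize u \/ exists n, stage n u v).

Lemma limit_refl u : limit_rel u u.
Proof. by split=> //; right; exists 0%N. Qed.

Lemma limit_sym u v : limit_rel u v -> limit_rel v u.
Proof.
move=> [suv [large|[n uv]]]; split=> //; first by left; rewrite -suv.
by right; exists n; exact: stage_sym.
Qed.

Lemma limit_trans u v w : limit_rel u v -> limit_rel v w -> limit_rel u w.
Proof.
move=> [suv [large|[m uv]]] [svw]; first by split; [rewrite suv | left].
case=> [large|[n vw]]; first by split; [rewrite suv | left; rewrite suv].
split; [by rewrite suv | right; exists (maxn m n)].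
apply: stage_trans (stage_leq (leq_maxl m n) uv) _.
exact: stage_leq (leq_maxr m n) vw.
Qed.

Lemma limit_add u v w : limit_rel u v -> limit_rel (u + w) (v + w).
Proof.
move=> [suv uv]; split; first by rewrite !wsizeD suv.
case: uv => [large|[n uv]]; last by right; exists n; exact: stage_add.
by left; rewrite wsizeD; apply: le_trans large _; rewrite lerDl wsize_ge0.
Qed.

End Tower.

(** * The quotient monoid and an enumeration of all refinement data *)

Lemma nmod_quotient (W : nmodType) (R : W -> W -> Prop) :
  (forall u, R u u) -> (forall u v, R u v -> R v u) ->
  (forall u v w, R u v -> R v w -> R u w) ->
  (forall u v w, R u v -> R (u + w) (v + w)) ->
  exists (Q : nmodType) (q : W -> Q),
    [/\ q 0 = 0, {morph q : u v / u + v}, (forall x, exists u, x = q u) &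
        forall u v, q u = q v <-> R u v].
Proof.
move=> Rrefl Rsym Rtrans Radd.
pose e u v := `[< R u v >].
have e_refl : reflexive e by move=> u; apply/asboolP.
have e_sym : symmetric e by move=> u v; apply/asboolP/asboolP; exact: Rsym.
have e_trans : transitive e.
  by move=> v u w /asboolP uv /asboolP vw; apply/asboolP/(Rtrans u v w).
pose eR := EquivRel e e_refl e_sym e_trans.
pose Q := {eq_quot eR}.
have piE u v : \pi_Q u = \pi_Q v <-> R u v.
  by split=> [/eqmodP/asboolP //|uv]; apply/eqmodP/asboolP.
have [add addE] : exists add : Q -> Q -> Q,
    forall u v, add (\pi_Q u) (\pi_Q v) = \pi_Q (u + v).
  exists (fun x y => \pi_Q (repr x + repr y)) => u v.
  have reprR w : R (repr (\pi_Q w)) w by apply/piE; rewrite reprK.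
  apply/piE; apply: (Rtrans _ (u + repr (\pi_Q v))); first by apply: Radd.
  by rewrite ![u + _]addrC; apply: Radd.
have addA : associative add.
  by move=> x y z; rewrite -[x]reprK -[y]reprK -[z]reprK !addE addrA.
have addC : commutative add.
  by move=> x y; rewrite -[x]reprK -[y]reprK !addE addrC.
have add0 : left_id (\pi_Q 0) add.
  by move=> x; rewrite -[x]reprK addE add0r.
pose mQ := GRing.isNmodule.Build Q addA addC add0.
pose nQ : nmodType := HB.pack Q mQ.
exists nQ, (fun u => \pi_Q u); split=> //.
by move=> x; exists (repr x); rewrite reprK.
Qed.

(** Words are given by coefficient sequences, so that the codes form a countable type; the second
    component prescribes the letter sizes. *)
Definition word_code : Type :=
  {ffun bool * 'I_2 -> seq 'M[nat]_2} * {ffun 'I_2 * 'I_2 -> rat}.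

(* Each code [d] is used at the infinitely many stages [n] whose 2-adic valuation is
   [pickle d], in particular at stages after which its words are available. *)
Definition stage_code (n : nat) : word_code :=
  odflt ([ffun=> [::]], [ffun=> 0]) (unpickle (logn 2 n)).

Lemma stage_codeP (d : word_code) (N : nat) :
  exists2 n, (N <= n)%N & stage_code n = d.
Proof.
(* The odd cofactor fixes the valuation at [pickle d] and makes the product at least [N]. *)
exists (2 ^ pickle d * N.*2.+1)%N.
  by have : (0 < 2 ^ pickle d)%N; [rewrite expn_gt0 | nia].
rewrite /stage_code lognM ?expn_gt0 // pfactorK // lognE /= dvdn2 /= odd_double.
by rewrite addn0 pickleK.
Qed.

(** The default 1 replaces nonpositive prescriptions, so that every letter has positive size. *)
Definition letter_size (n : nat) (i j : 'I_2) : rat :=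
  let s := (stage_code n).2 (i, j) in if 0 < s then s else 1.

Definition stage_data (n : nat) (p : bool * 'I_2) : word := Poly ((stage_code n).1 p).

Lemma letter_size_gt0 n i j : 0 < letter_size n i j.
Proof. by rewrite /letter_size; case: ifP. Qed.

Lemma stage_prescribed (x : bool * 'I_2 -> word) (s : 'I_2 -> 'I_2 -> rat) (N : nat) :
  (forall i j, 0 < s i j) ->
  exists n, [/\ (N <= n)%N, stage_data n =1 x & forall i j, letter_size n i j = s i j].
Proof.
move=> s_gt0.
have [n Nn nE] := stage_codeP ([ffun p => x p : seq _], [ffun p => s p.1 p.2]) N.
exists n; split=> // [p|i j].
  by rewrite /stage_data nE ffunE polyseqK.
by rewrite /letter_size nE ffunE /= s_gt0.
Qed.

Notation size_of := (wsize letter_size).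
Notation rel_stage := (stage letter_size stage_data).
Notation rel_limit := (limit_rel letter_size stage_data).

Lemma line_delta b i :
  line (b, i) = \sum_j if b then delta_mx j i else delta_mx i j.
Proof.
apply/matrixP => k l; rewrite summxE !mxE /=.
case: b; [rewrite (bigD1 k) //= | rewrite (bigD1 l) //=];
  rewrite mxE eqxx ?andbT natn big1 ?addr0 //= => j /negPf;
  by rewrite mxE eq_sym => ->; rewrite ?andbF.
Qed.

Lemma weight_delta (t : nat -> 'I_2 -> 'I_2 -> rat) n i j :
  weight t n (delta_mx i j) = t n i j.
Proof.
rewrite /weight (bigD1 i) //= (bigD1 j) //= mxE !eqxx mul1r.
rewrite big1 => [|l /negPf lj]; last by rewrite mxE lj andbF mul0r.
rewrite addr0 big1 ?addr0 // => k /negPf ki.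
by rewrite big1 // => l _; rewrite mxE ki mul0r.
Qed.

Lemma weight_line (t : nat -> 'I_2 -> 'I_2 -> rat) n b i :
  weight t n (line (b, i)) = \sum_j if b then t n j i else t n i j.
Proof.
rewrite line_delta !big_ord_recl !big_ord0 !addr0 weightD.
by case: b; rewrite !weight_delta.
Qed.

Lemma limit_refinement x1 x2 y1 y2 :
  0 < size_of x1 -> 0 < size_of x2 -> 0 < size_of y1 -> 0 < size_of y2 ->
  rel_limit (x1 + x2) (y1 + y2) ->
  exists z11 z12 z21 z22, [/\ rel_limit x1 (z11 + z12), rel_limit x2 (z21 + z22),
    rel_limit y1 (z11 + z21) & rel_limit y2 (z12 + z22)].
Proof.
move=> x1_gt0 x2_gt0 y1_gt0 y2_gt0 [size_xy rel_xy].
pose xs (p : bool * 'I_2) : word := if p.1 then if p.2 == ord0 then y1 else y2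
                           else if p.2 == ord0 then x1 else x2.
pose tot := size_of (x1 + x2).
(* The product of the margins divided by the total size is positive and has the required row and
   column sums. *)
pose s i j := size_of (xs (false, i)) * size_of (xs (true, j)) / tot.
have tot_gt0 : 0 < tot by rewrite /tot wsizeD addr_gt0.
have s_gt0 i j : 0 < s i j.
  by rewrite divr_gt0 // mulr_gt0 // /xs /=; case: ifP.
have [m rel_m] : exists m, rel_stage m (x1 + x2) (y1 + y2) \/ 1 <= tot.
  by case: rel_xy => [large|[m xy]]; [exists 0%N; right | exists m; left].
(* The stage is late enough that the four words use earlier letters only and that the equation, if
   small, already holds. *)
have [n [le_n gE tE]] :=
  stage_prescribed xs (maxn m (\max_p size (xs p))) s_gt0.
have sum_xs b : \sum_i xs (b, i) = if b then y1 + y2 else x1 + x2.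
  by rewrite big_ord_recl big_ord1; case: b.
have size_sum b : \sum_i size_of (xs (b, i)) = tot.
  rewrite big_ord_recl big_ord1 -wsizeD.
  by have := sum_xs b; rewrite big_ord_recl big_ord1 => ->; case: b.
have margins p : size_of (xs p) = weight letter_size n (line p).
  case: p => b i; rewrite weight_line.
  transitivity (\sum_j size_of (xs (b, i)) * size_of (xs (~~ b, j)) / tot).
    by rewrite -mulr_suml -mulr_sumr size_sum mulfK // gt_eqF.
  apply: eq_bigr => j _; case: b; rewrite tE /s //=.
  by rewrite [_ * size_of (xs (false, j))]mulrC.
have act : active letter_size stage_data (rel_stage n) n.
  split=> [p|p|].
  - rewrite gE; apply: leq_trans le_n; rewrite leq_max; apply/orP; right.
    exact: (leq_bigmax (F := fun p => size (xs p))).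
  - by rewrite gE wsize_letters margins.
  - rewrite !(eq_bigr _ (fun i _ => gE (_, i))) !sum_xs.
    case: rel_m => [xy|large].
      by left; apply: stage_leq xy; apply: leq_trans le_n; exact: leq_maxl.
    right; rewrite wsize_letters -(sum_line false).
    rewrite big_ord_recl big_ord1 weightD -!margins -wsizeD.
    by have := sum_xs false; rewrite big_ord_recl big_ord1 => ->.
have rel_line p : rel_limit (xs p) (letters n (line p)).
  split; first by rewrite wsize_letters margins.
  right; exists n.+1; apply: closure_base; right; split=> //.
  by exists p; rewrite ?gE.
have letters_line b i : letters n (line (b, i)) =
    letters n (if b then delta_mx ord0 i else delta_mx i ord0) +
    letters n (if b then delta_mx (lift ord0 ord0) i
               else delta_mx i (lift ord0 ord0)).
  by rewrite line_delta big_ord_recl big_ord1 lettersD.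
pose z i j := letters n (delta_mx i j).
pose o : 'I_2 := ord0; pose o' : 'I_2 := lift ord0 ord0.
exists (z o o), (z o o'), (z o' o), (z o' o'); split.
- by have := rel_line (false, o); rewrite letters_line.
- by have := rel_line (false, o'); rewrite letters_line.
- by have := rel_line (true, o); rewrite letters_line.
- by have := rel_line (true, o'); rewrite letters_line.
Qed.

(** A single letter has the prescribed size, whether or not its stage is active. *)
Lemma size_of_surjective (q : rat) : 0 < q -> exists w, size_of w = q.
Proof.
move=> q_gt0.
have [n [_ _ tE]] := stage_prescribed (fun=> 0) 0 (fun _ _ : 'I_2 => q_gt0).
by exists (letters n (delta_mx ord0 ord0)); rewrite wsize_letters weight_delta tE.
Qed.

(** Letters of size 1/2 are placed at a stage whose prescribed words are 0: the sizes disagree, so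
    that stage is inactive, and all other stages are conservative over its letters. Two of these
    letters stay distinct, but adding one of them to both gives words of size 1, which are
    identified. *)
Lemma limit_not_cancellative : exists u v w,
  ~ rel_limit u v /\ rel_limit (u + w) (v + w).
Proof.
have half_gt0 : 0 < 1 / 2 :> rat by lra.
have [n [_ gE tE]] := stage_prescribed (fun=> 0) 0 (fun _ _ : 'I_2 => half_gt0).
pose z j := letters n (delta_mx (ord0 : 'I_2) (j : 'I_2)).
have size_z j : size_of (z j) = 1 / 2 by rewrite wsize_letters weight_delta tE.
exists (z ord0), (z (lift ord0 ord0)), (z ord0); split; last first.
  by split; rewrite !wsizeD !size_z; [|left]; lra.
case=> _ []; first by rewrite size_z; lra.
case; elim=> [|m IHm].
  move/(congr1 (fun w : word => w`_n ord0 ord0)).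
  by rewrite /= !coef_letters eqxx !mxE.
case: (eqVneq m n) IHm => [->|mn] IHm.
  move=> /stage_inactive zz; apply: IHm; apply: zz => -[_ /(_ (false, ord0)) + _].
  rewrite gE wsize0 wsize_letters weight_line big_ord_recl big_ord1 !tE; lra.
move=> /(stage_conservative letter_size_gt0) zz; apply: IHm; apply: zz.
- by rewrite coef_letters (negPf mn).
- by rewrite coef_letters (negPf mn).
- by rewrite size_z; lra.
Qed.

(** * The three example monoids *)

Lemma noncancellative_example : exists N : nmodType,
  [/\ simple_conical_refinement N, ~ cancellative N &
      exists (a : N) (n : nat), [/\ a <> 0, (0 < n)%N & sr_condition a n]].
Proof.
have [N [q [q0 qD qsurj qE]]] := nmod_quotient
  (@limit_refl letter_size stage_data) (@limit_sym letter_size stage_data)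
  (@limit_trans letter_size stage_data) (@limit_add _ stage_data letter_size_gt0).
have sizeD := wsizeD letter_size.
have size_ge0 := wsize_ge0 letter_size_gt0.
have q_eq0 u : q u = 0 <-> size_of u = 0.
  split; first by rewrite -q0 => /qE[-> _]; exact: wsize0.
  by move/(wsize_eq0 letter_size_gt0) ->.
have q_gt0 u : q u <> 0 -> 0 < size_of u.
  by move=> u0; rewrite lt_neqAle size_ge0 andbT eq_sym; apply/eqP => /q_eq0.
have q_large u v : size_of u = size_of v -> 1 <= size_of u -> q u = q v.
  by move=> uv u1; apply/qE; split=> //; left.
have qMn u n : q (u *+ n) = q u *+ n.
  by elim: n => [|n IHn]; rewrite ?q0 // !mulrS qD IHn.
have conN : conical N.
  move=> x y; have [u ->] := qsurj x; have [v ->] := qsurj y.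
  rewrite -qD => /q_eq0; rewrite sizeD => /eqP.
  by rewrite paddr_eq0 // => /andP[/eqP u0 /eqP v0]; split; apply/q_eq0.
have archQ (r s : rat) : 0 < s -> exists n : nat, r <= s *+ n.
  move=> s_gt0; exists (Num.bound (`|r| / s)); apply: le_trans (ler_norm r) _.
  rewrite -mulr_natl -ler_pdivrMr // ltW // archi_boundP //.
  by rewrite divr_ge0 ?normr_ge0 // ltW.
have archN (a x : N) : a <> 0 -> exists n, alg_le x (a *+ n).
  have [u ->] := qsurj a; have [v ->] := qsurj x => /q_gt0 u_gt0.
  (* The extra 1 makes the complement of [v] positive in size and the multiple of [u] large enough
     to be determined by its size. *)
  have [n lt_n] : exists n : nat, size_of v + 1 <= size_of u *+ n.
    exact: archQ.
  have v0 := size_ge0 v.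
  have [w w_size] : exists w, size_of w = size_of u *+ n - size_of v.
    by apply: size_of_surjective; lra.
  exists n, (q w); rewrite -qD -qMn; apply: q_large; rewrite sizeD w_size.
    by rewrite wsizeMn subrKC.
  by lra.
have [u [v [w [uv uvw]]]] := limit_not_cancellative.
have ncN : ~ cancellative N.
  by move=> cN; apply/uv/qE/(cN _ _ (q w)); rewrite -!qD; apply/qE.
have [a a0] : exists a : N, a <> 0.
  apply: contrapT => all0; apply: ncN => x y z _.
  have eq0 (b : N) : b = 0 by apply: contrapT => b0; apply: all0; exists b.
  by rewrite (eq0 x) (eq0 y).
exists N; split=> //; last first.
  have [u0 au0] := qsurj a; have u0_gt0 : 0 < size_of u0 by apply: q_gt0; rewrite -au0.
  have [n un] := archQ 1 _ u0_gt0.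
  (* Sizes cancel, and [n] copies of [u0] have size at least 1, so the remainder [u0 *+ n] works for
     size reasons alone. *)
  exists a, n.+1; split=> // x y; rewrite au0 mulrS -addrA.
  have [u1 ->] := qsurj x; have [v1 ->] := qsurj y.
  rewrite -qMn -!qD => /qE[]; rewrite !sizeD wsizeMn => /addrI size_eq _.
  exists (q (u0 *+ n)); first by rewrite qD.
  rewrite -qD; apply: q_large; rewrite sizeD wsizeMn //.
  by apply: le_trans un _; rewrite lerDl.
split=> //; first split.
- move/seteqP => [_ /(_ a I) [b ab]]; apply: a0; exact: (conN _ _ ab).1.
- move=> J [[J0 JD] Jle].
  have [[b [Jb b0]]|J_0] := pselect (exists b, J b /\ b <> 0).
    right; apply/seteqP; split=> // x _; have [n xn] := archN b x b0.
    by apply: Jle xn _; elim: n => [|n IHn] //; rewrite mulrS; apply: JD.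
  left; apply/seteqP; split=> x.
    move=> Jx; exists 0; rewrite addr0; apply: contrapT => x0.
    by apply: J_0; exists x.
  by move=> [y /conN[-> _]].
- move=> x1 x2 y1 y2 eq_xy.
  (* Zero summands are refined by hand, since free letters have positive size. *)
  have [x10|x10] := pselect (x1 = 0).
    exists 0, 0, y1, y2; rewrite x10 add0r in eq_xy *; split; rewrite ?addr0 ?add0r //.
  have [x20|x20] := pselect (x2 = 0).
    exists y1, y2, 0, 0; rewrite x20 addr0 in eq_xy *; split; rewrite ?addr0 ?add0r //.
  have [y10|y10] := pselect (y1 = 0).
    exists 0, x1, 0, x2; rewrite y10 add0r in eq_xy *; split; rewrite ?addr0 ?add0r //.
  have [y20|y20] := pselect (y2 = 0).
    exists x1, 0, x2, 0; rewrite y20 addr0 in eq_xy *; split; rewrite ?addr0 ?add0r //.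
  move: eq_xy x10 x20 y10 y20; have [u1 ->] := qsurj x1; have [u2 ->] := qsurj x2.
  have [v1 ->] := qsurj y1; have [v2 ->] := qsurj y2.
  rewrite -!qD => /qE eq_uv /q_gt0 u10 /q_gt0 u20 /q_gt0 v10 /q_gt0 v20.
  have [z11 [z12 [z21 [z22 [zu1 zu2 zv1 zv2]]]]] :=
    limit_refinement u10 u20 v10 v20 eq_uv.
  exists (q z11), (q z12), (q z21), (q z22); rewrite -!qD.
  by split; apply/qE.
Qed.

Lemma nat_simple_conical_refinement : simple_conical_refinement nat.
Proof.
have conN : conical nat.
  by move=> x y /eqP; rewrite addn_eq0 => /andP[/eqP-> /eqP->].
split=> //; first split.
- by move/seteqP => [_ /(_ 1%N I) [b /conN[]]].
- move=> J [[J0 JD] Jle]; have [J1|J1] := pselect (J 1%N).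
    right; apply/seteqP; split=> // n _; elim: n => // n IHn.
    by rewrite -addn1; apply: JD.
  left; apply/seteqP; split=> [[|n]|n]; first by exists 0%N.
    by move=> Jn; case: J1; apply: Jle Jn; exists n.
  by move=> [y /conN[-> _]].
- move=> x1 x2 y1 y2; rewrite -![(_ + _)%R]/(_ + _)%N => eq_xy.
  exists (minn x1 y1), (x1 - y1)%N, (y1 - x1)%N, (minn x2 y2).
  by rewrite -![(_ + _)%R]/(_ + _)%N; split; lia.
Qed.

(** In the two-element monoid with zero [None] and idempotent [Some tt], every positive multiple of
    [Some tt] is [Some tt]; taking [x = Some tt] and [y = 0] would force [e + Some tt = 0]. *)
Lemma idempotent_example : exists N : nmodType,
  simple_conical_refinement N /\
  forall (a : N) (n : nat), a <> 0 -> (0 < n)%N -> ~ sr_condition a n.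
Proof.
pose T := option unit.
pose add (x y : T) : T := if x is None then y else x.
have addA : associative add by move=> [[]|] [[]|] [[]|].
have addC : commutative add by move=> [[]|] [[]|].
have add0 : left_id None add by [].
pose mT := GRing.isNmodule.Build T addA addC add0.
pose N : nmodType := HB.pack T mT.
have conN : conical N by move=> [[]|] [[]|].
exists N; split; last first.
  move=> [[]|] n // _ n0 /(_ (Some tt) None) [].
    by case: n n0 => // n _; rewrite mulrS.
  by move=> e _ /conN[].
split=> //; first split.
- by move/seteqP => [_ /(_ (Some tt) I) [b /conN[]]].
- move=> J [[J0 JD] Jle]; have [J1|J1] := pselect (J (Some tt)).
    by right; apply/seteqP; split=> // -[[]|].
  left; apply/seteqP; split=> [[[]|]|[[]|]] //; first by exists None.
  by move=> [y /conN[]].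
- move=> x1 x2 y1 y2 eq_xy.
  exists (if x1 is None then None else y1), (if x1 is None then None else y2).
  exists (if x2 is None then None else y1), (if x2 is None then None else y2).
  by case: x1 x2 y1 y2 eq_xy => [[]|] [[]|] [[]|] [[]|].
Qed.

Theorem theoremE :
  (forall M : nmodType, simple_conical_refinement M ->
     ((exists B : nat, forall a : M,
         exists2 n : nat, stable_rank a = Some n & (n <= B)%N) ->
      cancellative M /\ (forall a : M, stable_rank a = Some 1%N))
     /\
     [\/ stable_ranks M = [set Some 1%N],
         stable_ranks M = [set None]
       | stable_ranks M = [set Some n | n in [set n : nat | (2 <= n)%N]]])
  /\
  [/\ exists N : nmodType,
        simple_conical_refinement N /\ stable_ranks N = [set Some 1%N],
      exists N : nmodType,
        simple_conical_refinement N /\ stable_ranks N = [set None]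
    & exists N : nmodType,
        simple_conical_refinement N /\
        stable_ranks N = [set Some n | n in [set n : nat | (2 <= n)%N]]].
Proof.
split.
- move=> M [simM conM refM]; split.
    move=> [B srB].
    have cM : cancellative M.
      (* The successor provides a positive bound even for [B = 0]. *)
      apply: (@sr_condition_bounded_cancellative M simM conM B.+1) => // a.
      have [n /stable_rankP[_ sn _] nB] := srB a.
      exact: sr_condition_leq (leqW nB) sn.
    by split=> // a; apply: cancellative_stable_rank.
  have [cM|ncM] := pselect (cancellative M).
    by constructor 1; apply: stable_ranks_cancellative.
  have [fin|inf] := pselect
    (exists (a : M) (n : nat), [/\ a <> 0, (0 < n)%N & sr_condition a n]).
    by constructor 3; apply: stable_ranks_ge2.
  constructor 2; apply: stable_ranks_infinite => // a n a0 n0 sa.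
  by apply: inf; exists a, n.
- split.
  + exists nat; split; first exact: nat_simple_conical_refinement.
    have [simN conN _] := nat_simple_conical_refinement.
    by apply: stable_ranks_cancellative => // x y z /addIn.
  + have [N [scrN inf]] := idempotent_example; exists N; split=> //.
    by have [simN conN _] := scrN; apply: stable_ranks_infinite.
  + have [N [scrN ncN fin]] := noncancellative_example; exists N; split=> //.
    by have [simN conN refN] := scrN; apply: stable_ranks_ge2.
Qed.
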